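(* Let $G$ be a group. (i) Suppose that $G$ has an element of infinite order. Then $\mathcal L(G)$ and $\mathcal L(\mathbb Z)$ are asymorphic if and only if $G\simeq\mathbb Z$. (ii) Suppose that $G$ is abelian. Then $\mathcal L(G)$ and $\mathcal L(\mathbb Z)$ are asymorphic if and only if either $G\simeq\mathbb Z$ or $G\simeq\mathbb Z_{p^\infty}$ for some prime $p$.
   Context: A ballean is a triple $(X,P,B)$ where $X,P$ are sets, $P\ne\emptyset$, and $B\colon X\times P\to\mathcal P(X)$ satisfies: $x\in B(x,\alpha)$; $x\in B(y,\alpha)$ iff $y\in B(x,\alpha)$; and for all $\alpha,\beta\in P$ there is $\gamma\in P$ such that $B(B(x,\alpha),\beta)\subseteq B(x,\gamma)$ for every $x\in X$, where $B(A,\delta)=\bigcup_{y\in A}B(y,\delta)$. A map $f\colon X\to Y$ between balleans $(X,P_X,B_X)$ and $(Y,P_Y,B_Y)$ is bornologous if for every $\alpha\in P_X$ there is $\beta\in P_Y$ with $f(B_X(x,\alpha))\subseteq B_Y(f(x),\beta)$ for all $x\in X$. An asymorphism is a bijection $f$ such that $f$ and $f^{-1}$ are bornologous; two balleans are asymorphic if there is an asymorphism between them. For a group $G$, the finitary ballean is $\mathcal B_G=(G,[G]^{<\omega},B_G)$, where $[G]^{<\omega}$ is the family of finite subsets of $G$ and $B_G(x,F)=\{x\}\cup Fx\cup F^{-1}x$. Let $L(G)$ be the set of all subgroups of $G$. The subgroup exponential hyperballean $\mathcal L(G)$ is the ballean with support $L(G)$, set of radii $[G]^{<\omega}$, and balls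 $B_{\mathcal L(G)}(H,F)=\{K\in L(G): K\subseteq B_G(H,F),\ H\subseteq B_G(K,F)\}$, where $B_G(A,F)=\bigcup_{y\in A}B_G(y,F)$. $\mathbb Z_{p^\infty}$ denotes the Prüfer $p$-group. *)

(* Defs.v *)
From HB Require Import structures.
From mathcomp Require Import all_boot all_algebra all_fingroup all_field.
From mathcomp Require Import finmap.
From mathcomp Require Import boolp classical_sets.

Set Implicit Arguments.
Unset Strict Implicit.
Unset Printing Implicit Defensive.

Import GRing.Theory.

Local Open Scope classical_set_scope.
Local Open Scope group_scope.

Record ballean := Ballean {
  supp :> Type;
  radius : Type;
  bball : supp -> radius -> set supp;
  radius_inh : inhabited radius;
  bball_refl : forall x a, bball x a x;
  bball_sym : forall x y a, bball y a x <-> bball x a y;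
  bball_mul : forall a b, exists c, forall x,
    \bigcup_(y in bball x a) bball y b `<=` bball x c
}.

Definition bball_set (X : ballean) (A : set X) (a : radius X) : set X :=
  \bigcup_(y in A) bball y a.

Definition bornologous (X Y : ballean) (f : X -> Y) : Prop :=
  forall a : radius X, exists b : radius Y,
    forall x : X, f @` bball x a `<=` bball (f x) b.

Definition asymorphism (X Y : ballean) (f : X -> Y) : Prop :=
  exists g : Y -> X,
    [/\ cancel f g, cancel g f, bornologous f & bornologous g].

Definition asymorphic (X Y : ballean) : Prop :=
  exists f : X -> Y, asymorphism f.

Section Finitary.
Variable G : groupType.
Implicit Types (x y : G) (E F : {fset G}).

Definition fin_ball x F : set G :=
  [set x] `|` [set g * x | g in [set` F]] `|` [set g^-1 * x | g in [set` F]].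

Lemma fin_ball_refl x F : fin_ball x F x.
Proof. by left; left. Qed.

Lemma fin_ball_sym x y F : fin_ball y F x <-> fin_ball x F y.
Proof.
have sub a b : fin_ball b F a -> fin_ball a F b.
  case=> [[->|[g Fg <-]]|[g Fg <-]]; first exact: fin_ball_refl.
    by right; exists g; rewrite // mulKg.
  by left; right; exists g; rewrite // mulVKg.
by split; apply: sub.
Qed.

Let sym F : {fset G} := (1 |` F `|` [fset g^-1 | g in F])%fset.

Let fin_ballP x F y : fin_ball x F y -> exists2 g, g \in sym F & y = g * x.
Proof.
case=> [[->|[g Fg <-]]|[g Fg <-]].
- by exists 1; rewrite ?mul1g // !inE eqxx.
- by exists g; rewrite // !inE (Fg : g \in F) orbT.
- exists g^-1; rewrite // in_fsetU; apply/orP; right.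
  exact: (in_imfset _ (fun g => g^-1)).
Qed.

Definition fin_prod E F : {fset G} := [fset g * h | g in sym F, h in sym E]%fset.

Lemma fin_ball_mul E F x :
  \bigcup_(y in fin_ball x E) fin_ball y F `<=` fin_ball x (fin_prod E F).
Proof.
move=> z [y /fin_ballP[h Eh ->] /fin_ballP[g Fg ->]].
left; right; exists (g * h); rewrite ?mulgA //=.
exact: in_imfset2.
Qed.

Definition finitary_ballean : ballean :=
  Ballean (inhabits fset0) fin_ball_refl fin_ball_sym
    (fun E F => ex_intro _ (fin_prod E F) (@fin_ball_mul E F)).

End Finitary.

Record subgroup (G : groupType) := Subgroup {
  sg_set :> set G;
  sg1 : sg_set 1;
  sgM : forall x y, sg_set x -> sg_set y -> sg_set (x * y);
  sgV : forall x, sg_set x -> sg_set x^-1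
}.

Section SubgroupHyperballean.
Variable G : groupType.
Implicit Types (H K : subgroup G) (E F : {fset G}).
Local Notation BG := (@bball_set (finitary_ballean G)).

Definition sg_ball H F : set (subgroup G) :=
  [set K : subgroup G | K `<=` BG H F /\ H `<=` BG K F].

Lemma sg_ball_refl H F : sg_ball H F H.
Proof. by split=> x Hx; exists x => //; apply: fin_ball_refl. Qed.

Lemma sg_ball_sym H K F : sg_ball K F H <-> sg_ball H F K.
Proof. by split=> -[]. Qed.

Let BG_mul (A : set G) E F (D : {fset G}) : {subset fin_prod E F <= D} ->
  BG (BG A E) F `<=` BG A D.
Proof.
move=> sD z [y [x Ax xy] yz]; exists x => //.
have /= : fin_ball x (fin_prod E F) z by apply: fin_ball_mul; exists y.
by case=> [[->|[g Fg <-]]|[g Fg <-]];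
  [left; left|left; right; exists g|right; exists g] => //; apply: sD.
Qed.

Let BGS (A A' : set G) F : A `<=` A' -> BG A F `<=` BG A' F.
Proof. by move=> sA z [x /sA]; exists x. Qed.

Lemma sg_ball_mul E F : exists D, forall H,
  \bigcup_(K in sg_ball H E) sg_ball K F `<=` sg_ball H D.
Proof.
exists (fin_prod E F `|` fin_prod F E)%fset => H J [K [KH HK] [JK KJ]]; split.
  apply: subset_trans (BG_mul (E := E) (F := F) _) => [|g].
    exact: subset_trans JK (BGS KH).
  by rewrite in_fsetU => ->.
apply: subset_trans (BG_mul (E := F) (F := E) _) => [|g].
  exact: subset_trans HK (BGS KJ).
by rewrite in_fsetU orbC => ->.
Qed.

Definition sg_hyperballean : ballean :=
  Ballean (inhabits fset0) sg_ball_refl sg_ball_sym sg_ball_mul.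

End SubgroupHyperballean.

Definition isomorphic_groups (G H : groupType) : Prop :=
  exists f : {multiplicative G -> H}, bijective f.

Definition Zgroup : groupType := Algebra.to_multiplicative int.

(* The Pruefer p-group, as the group of complex roots of unity whose order is a
   power of p; they are all algebraic, so algC can play the role of C.  The type
   takes the primality proof as an argument because for p = 0 the predicate
   below would hold of all z, including 0. *)
Section Pruefer.
Variables (p : nat) (p_pr : prime p).

Definition pruefer_pred (z : algC) : bool :=
  `[< exists n : nat, (z ^+ (p ^ n)%N = 1)%R >].

Definition pruefer of prime p : Type := {z : algC | pruefer_pred z}.

Local Notation T := (pruefer p_pr).

HB.instance Definition _ := Choice.copy T {z : algC | pruefer_pred z}.

Let pruefer1 : pruefer_pred 1%R.
Proof. by apply/asboolP; exists 0; rewrite expr1n. Qed.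

Let prueferM z w : pruefer_pred z -> pruefer_pred w -> pruefer_pred (z * w)%R.
Proof.
move=> /asboolP[m zm] /asboolP[n wn]; apply/asboolP; exists (m + n)%N.
by rewrite exprMn expnD exprM zm mulnC exprM wn !expr1n mulr1.
Qed.

Let prueferV z : pruefer_pred z -> pruefer_pred (z^-1)%R.
Proof.
by move=> /asboolP[m zm]; apply/asboolP; exists m; rewrite exprVn zm invr1.
Qed.

Definition pruefer_one : T := exist _ 1%R pruefer1.
Definition pruefer_mul (u v : T) : T :=
  exist _ (sval u * sval v)%R (prueferM (svalP u) (svalP v)).
Definition pruefer_inv (u : T) : T :=
  exist _ (sval u)^-1%R (prueferV (svalP u)).

Let mulA : associative pruefer_mul.
Proof. by move=> u v w; apply/val_inj/mulrA. Qed.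

Let mul1 : left_id pruefer_one pruefer_mul.
Proof. by move=> u; apply/val_inj/mul1r. Qed.

Let mulC : commutative pruefer_mul.
Proof. by move=> u v; apply/val_inj/mulrC. Qed.

Let mul1' : right_id pruefer_one pruefer_mul.
Proof. by move=> u; rewrite mulC mul1. Qed.

Let mulV : left_inverse pruefer_one pruefer_inv pruefer_mul.
Proof.
case=> z /= zP; apply/val_inj/mulVf => /=; move: (zP) => /asboolP[n zn].
apply: contra_eq_neq zn => ->.
by rewrite expr0n expn_eq0 (gtn_eqF (prime_gt0 p_pr)) /= eq_sym oner_neq0.
Qed.

Let mulV' : right_inverse pruefer_one pruefer_inv pruefer_mul.
Proof. by move=> u; rewrite mulC mulV. Qed.

HB.instance Definition _ := isGroup.Build T mulA mul1 mul1' mulV mulV'.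

Definition pruefer_group : groupType := T.

End Pruefer.

(* Main.v *)
From HB Require Import structures.
From mathcomp Require Import all_boot all_order all_algebra algC cyclotomic.
From mathcomp Require Import finmap zify ring.
From mathcomp Require Import boolp classical_sets cardinality.
Require Import Defs.

(** Both L(Z) and L(Z_(p^oo)) have the same shape.  The trivial subgroup of Z
    is isolated; the subgroups nZ are pairwise commensurable, but at a given
    scale only finitely many of them have any neighbour.  In the Pruefer group
    it is the whole group that is isolated, while the finite subgroups, which
    form a chain, behave like the nZ.  This shape, called a [ray] below,
    determines a ballean up to asymorphism ([ray_asymorphic]); with [Z_ray],
    [tower_is_ray] and the functoriality of L ([isomorphic_asymorphic]) this
    gives the converse implications.

    For the direct implications it is enough that L(Z) has exactly two classes
    of commensurable subgroups, one of which is a single point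
    ([asymorphic_ray_linked]).  The class of the trivial subgroup of G consists
    of the finite subgroups ([linked_trivial]).

    If G has an element of infinite order, the cyclic group it generates is
    infinite and commensurable with a proper subgroup of itself, so the single
    point has to be the trivial subgroup.  Thus G is torsion-free and every
    nontrivial cyclic subgroup has finite index.  Any two nontrivial elements
    then have a common power, some power z of a given element is central
    ([central_power]), and the transfer homomorphism towards the subgroup
    generated by z ([transfer]) embeds G into Z.

    If G is abelian and torsion, the single point is G itself and all proper
    subgroups are finite.  Such a group is divisible ([roots_exist]), so a chain
    of p-th roots above an element of prime order p is infinite and exhausts it;
    this determines the group ([tower_isomorphic]). *)

Set Implicit Arguments.
Unset Strict Implicit.
Unset Printing Implicit Defensive.

Import Order.TTheory GRing.Theory Num.Theory.

Local Open Scope classical_set_scope.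
Local Open Scope group_scope.

(** * Linked points and rays *)

(** Being linked is invariant under asymorphisms, and it is all of the coarse
    structure that the two direct implications use.  In a hyperballean of
    subgroups, linked means commensurable. *)
Definition linked (X : ballean) (x y : X) := exists r, bball x r y.

Lemma bornologous_linked (X Y : ballean) (f : X -> Y) (x y : X) :
  bornologous f -> linked x y -> linked (f x) (f y).
Proof.
by move=> bf [r xy]; have [s fs] := bf r; exists s; apply: fs; exists y.
Qed.

Lemma asymorphism_linked (X Y : ballean) (f : X -> Y) (x y : X) :
  asymorphism f -> linked (f x) (f y) <-> linked x y.
Proof.
case=> g [fK gK bf bg]; split; last exact: bornologous_linked.
by move=> /(bornologous_linked bg); rewrite !fK.
Qed.

Lemma bornologous_comp (X Y Z : ballean) (f : X -> Y) (g : Y -> Z) :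
  bornologous f -> bornologous g -> bornologous (g \o f).
Proof.
move=> bf bg r; have [s fs] := bf r; have [t gt] := bg s; exists t => x.
by move=> _ [y xy <-]; apply: gt; exists (f y) => //; apply: fs; exists y.
Qed.

Lemma asymorphic_trans (X Y Z : ballean) :
  asymorphic X Y -> asymorphic Y Z -> asymorphic X Z.
Proof.
move=> [f [f' [fK f'K bf bf']]] [g [g' [gK g'K bg bg']]].
exists (g \o f), (f' \o g'); split; try exact: bornologous_comp.
- exact: can_comp.
- exact: can_comp.
Qed.

Definition low (N : nat) (a : option nat) : bool :=
  if a is Some i then i <= N else false.

(** The common shape of the hyperballeans of Z and of the Pruefer groups: an
    isolated point [e None], and a sequence [e (Some n)] which at every scale
    is bounded on a finite initial segment and discrete beyond it.  The second
    and third fields say that each radius is dominated by an initial segment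
    and conversely, so [e] determines the ballean up to asymorphism. *)
Record ray (X : ballean) (e : option nat -> X) : Prop := Ray {
  ray_bij : bijective e;
  ray_thin : forall r, exists N, forall a b,
    bball (e a) r (e b) -> a = b \/ (low N a /\ low N b);
  ray_coarse : forall N, exists r, forall a b,
    low N a -> low N b -> bball (e a) r (e b)
}.

Lemma ray_bornologous (X Y : ballean) (d : option nat -> X) (e : option nat -> Y)
    (d' : X -> option nat) :
  ray d -> ray e -> cancel d' d -> bornologous (e \o d').
Proof.
move=> rd re dK r; have [N thinN] := ray_thin rd r.
have [s coarse] := ray_coarse re N.
exists s => x _ [y xy <-] /=.
have := thinN (d' x) (d' y); rewrite !dK => /(_ xy)[->|[lx ly]].
  exact: bball_refl.
exact: coarse.
Qed.

Lemma ray_asymorphic (X Y : ballean) (d : option nat -> X) (e : option nat -> Y) :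
  ray d -> ray e -> asymorphic X Y.
Proof.
move=> rd re; case: (ray_bij rd) => d' dK d'K; case: (ray_bij re) => e' eK e'K.
exists (e \o d'), (d \o e'); split.
- by move=> x /=; rewrite eK d'K.
- by move=> y /=; rewrite dK e'K.
- exact: ray_bornologous rd re d'K.
- exact: ray_bornologous re rd e'K.
Qed.

Lemma ray_linked (X : ballean) (e : option nat -> X) (a b : option nat) :
  ray e -> linked (e a) (e b) <-> a = b \/ (a <> None /\ b <> None).
Proof.
move=> re; split.
  move=> [r ab]; have [N thinN] := ray_thin re r.
  have [->|[]] := thinN _ _ ab; first by left.
  by case: a {ab} => // i _; case: b => // j _; right.
case=> [->|]; first by have [r _] := ray_coarse re 0; exists r; apply: bball_refl.
case: a b => [i|] [j|] [] // _ _.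
have [r rP] := ray_coarse re (maxn i j); exists r; apply: rP => /=; lia.
Qed.

(** What remains of a ray when only the relation of being linked is kept:
    two classes, one of which is a single point. *)
Lemma asymorphic_ray_linked (X Y : ballean) (e : option nat -> Y) :
  asymorphic X Y -> ray e ->
  exists iso : X, (exists x, x <> iso) /\
    forall x y, linked x y <-> x = y \/ (x <> iso /\ y <> iso).
Proof.
move=> [f af] re; case: (af) => g [fK gK _ _]; case: (ray_bij re) => e' eK e'K.
exists (g (e None)); split.
  exists (g (e (Some 0))) => /(congr1 (e' \o f)) /=.
  by rewrite !gK !eK.
have inj : injective (e' \o f).
  by apply: (can_inj (g := g \o e)) => x /=; rewrite e'K.
move=> x y; rewrite -(asymorphism_linked _ _ af) -{1}[f x]e'K -{1}[f y]e'K.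
rewrite ray_linked //.
have eqiso z : z = g (e None) <-> e' (f z) = None.
  by split=> [->|/(congr1 e)]; rewrite ?gK ?eK // e'K => <-; rewrite fK.
rewrite !eqiso; split=> -[]; first by move=> /inj; left.
- by right.
- by move=> ->; left.
- by right.
Qed.

(** * Preliminaries and integer powers *)

Lemma pigeonhole (T : eqType) (s : seq T) (u : nat -> T) :
  (forall n, u n \in s) -> exists i j, i < j /\ u i = u j.
Proof.
move=> us; apply: contrapT => no.
have uu : uniq (map u (iota 0 (size s).+1)).
  rewrite map_inj_uniq ?iota_uniq // => i j uij.
  have [ij|ji|//] := ltngtP i j; case: no; first by exists i, j.
  by exists j, i.
have us' : {subset map u (iota 0 (size s).+1) <= s} by move=> x /mapP[i _ ->].
by have := uniq_leq_size uu us'; rewrite size_map size_iota ltnn.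
Qed.

Lemma inj_surj_bijective (T U : Type) (f : T -> U) :
  injective f -> (forall y, exists x, f x = y) -> bijective f.
Proof.
move=> f_inj /choice[g gK]; exists g => // x; exact/f_inj/gK.
Qed.

Section Zexp.
Variable G : groupType.
Implicit Types (g x y : G) (a b : int) (m n : nat).

Definition zexp g a : G :=
  match a with Posz n => g ^+ n | Negz n => g ^- n.+1 end.

Lemma zexpB g m n : zexp g (m%:Z - n%:Z)%R = g ^+ m / g ^+ n.
Proof.
have [nm|mn] := leqP n m.
  by rewrite subzn //= expgnFr.
have -> : (m%:Z - n%:Z)%R = Negz (n - m).-1 by rewrite NegzE; lia.
rewrite /= prednK ?subn_gt0 // expgnFr; last exact: ltnW.
by rewrite invgF.
Qed.

Lemma int_split a : exists m n : nat, a = (m%:Z - n%:Z)%R.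
Proof. by case: a => n; [exists n, 0; lia|exists 0, n.+1; lia]. Qed.

Lemma zexpD g a b : zexp g (a + b)%R = zexp g a * zexp g b.
Proof.
have [m [n ->]] := int_split a; have [k [l ->]] := int_split b.
have -> : ((m%:Z - n%:Z) + (k%:Z - l%:Z) = (m + k)%N%:Z - (n + l)%N%:Z)%R by lia.
rewrite !zexpB [(n + l)%N]addnC !expgnDr invgM !mulgA; congr (_ * _).
by rewrite -!mulgA; congr (_ * _); apply/commuteV/commuteX2.
Qed.

Lemma zexp1 g : zexp g 1%R = g. Proof. by []. Qed.

Lemma zexpN g a : zexp g (- a)%R = (zexp g a)^-1.
Proof. by apply/esym/mulg1_eq; rewrite -zexpD subrr. Qed.

Lemma zexpX g a n : zexp g a ^+ n = zexp g (a * n%:Z)%R.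
Proof.
elim: n => [|n IHn]; first by rewrite mulr0.
by rewrite expgS IHn -zexpD; congr zexp; lia.
Qed.

Lemma zexpM g a b : zexp (zexp g a) b = zexp g (a * b)%R.
Proof.
by case: b => n /=; rewrite zexpX // -zexpN; congr zexp; rewrite NegzE; lia.
Qed.

Lemma zexp_commute g x a : commute x g -> commute x (zexp g a).
Proof. by case: a => n xg /=; [|apply: commuteV]; apply: commuteX. Qed.

Lemma zexp_inj g : (forall n, 0 < n -> g ^+ n <> 1) -> injective (zexp g).
Proof.
move=> infg a b gab; have {gab} : zexp g (a - b)%R = 1.
  by rewrite zexpD zexpN gab mulgV.
have : ((a - b)%R = 0%R -> a = b) by lia.
case: (a - b)%R => n ab /=.
  case: n ab => [|n] ab; first by move=> _; apply: ab.
  by move=> gn1; case: (infg n.+1).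
by rewrite -{1}invg1 => /invg_inj gn1; case: (infg n.+1).
Qed.

End Zexp.

Section Morphism.
Variables (G H : groupType) (f : {multiplicative G -> H}).

Lemma hom1 : f 1 = 1.
Proof. by apply: (mulIg (f 1)); rewrite -gmulfM !mul1g. Qed.

Lemma homV x : f x^-1 = (f x)^-1.
Proof. by apply/esym/mulg1_eq; rewrite -gmulfM mulgV hom1. Qed.

Lemma homX x n : f (x ^+ n) = f x ^+ n.
Proof. by elim: n => [|n IHn]; rewrite ?hom1 // !expgS gmulfM IHn. Qed.

Lemma hom_zexp x a : f (zexp x a) = zexp (f x) a.
Proof. by case: a => n /=; rewrite ?homV homX. Qed.

End Morphism.

Lemma zexp_Zgroup (k : Zgroup) (a : int) :
  (zexp k a : int) = ((k : int) * a)%R.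
Proof.
have X n : ((k ^+ n)%g : int) = ((k : int) * n%:Z)%R.
  elim: n => [|n IHn]; first by rewrite mulr0; exact: erefl.
  rewrite expgS IHn.
  by have -> : ((k : int) * n.+1%:Z)%R = (k + (k : int) * n%:Z)%R by lia.
case: a => n; first exact: X.
by rewrite /= X -[LHS]/(- ((k : int) * n.+1%:Z))%R NegzE; lia.
Qed.

(** * Subgroups and the balls around them *)

Lemma subgroup_ext (G : groupType) (H K : subgroup G) :
  (forall x, sg_set H x <-> sg_set K x) -> H = K.
Proof.
case: H K => [H H1 HM HV] [K K1 KM KV] /= HK.
have {}HK : H = K by apply/seteqP; split=> x /HK.
by subst K; congr Subgroup; apply: Prop_irrelevance.
Qed.

Section Subgroups.
Variable G : groupType.
Implicit Types (H K : subgroup G) (F : {fset G}) (x g : G).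

Definition trivial_subgroup : subgroup G.
Proof.
by exists [set 1] => [|x y -> ->|x ->]; rewrite /= ?mulg1 ?invg1.
Defined.

Definition full_subgroup : subgroup G.
Proof. by exists setT. Defined.

Definition cycle_subgroup g : subgroup G.
Proof.
exists [set x | exists a, x = zexp g a].
- by exists 0%R.
- by move=> _ _ [a ->] [b ->]; exists (a + b)%R; rewrite zexpD.
- by move=> _ [a ->]; exists (- a)%R; rewrite zexpN.
Defined.

(** Membership in a ball involves 1, F and the inverses of F; collecting these
    in one finite set makes a ball around a subgroup a finite union of left
    translates. *)
Definition fsym F : {fset G} := (1 |` F `|` [fset g^-1 | g in F])%fset.

Lemma bball_set_fsym (A : set G) F x :
  @bball_set (finitary_ballean G) A F x ->
  exists f a, [/\ f \in fsym F, A a & x = f * a].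
Proof.
case=> a Aa [[->|[f Ff <-]]|[f Ff <-]].
- by exists 1, a; split; rewrite ?mul1g // !inE eqxx.
- by exists f, a; split; rewrite // !inE (Ff : f \in F) orbT.
- exists f^-1, a; split; rewrite // in_fsetU; apply/orP; right.
  exact: (in_imfset _ (fun g => g^-1)).
Qed.

Lemma bball_setM (A : set G) F f a :
  f \in F -> A a -> @bball_set (finitary_ballean G) A F (f * a).
Proof. by move=> Ff Aa; exists a => //; left; right; exists f. Qed.

Lemma bball_set_id (A : set G) F a :
  A a -> @bball_set (finitary_ballean G) A F a.
Proof. by move=> Aa; exists a => //; left; left. Qed.

Lemma subgroupX H g n : sg_set H g -> sg_set H (g ^+ n).
Proof.
by move=> Hg; elim: n => [|n Hn]; [apply: sg1|rewrite expgS; apply: sgM].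
Qed.

Lemma subgroupZ H g a : sg_set H g -> sg_set H (zexp g a).
Proof. by case: a => n Hg /=; [|apply: sgV]; apply: subgroupX. Qed.

Lemma linkedI H K F :
  (forall x, sg_set K x -> @bball_set (finitary_ballean G) H F x) ->
  (forall x, sg_set H x -> @bball_set (finitary_ballean G) K F x) ->
  @linked (sg_hyperballean G) H K.
Proof. by move=> KH HK; exists F; split. Qed.

Lemma linked_cover H K : @linked (sg_hyperballean G) H K ->
  exists F : {fset G}, forall x, sg_set K x ->
    exists f h, [/\ f \in F, sg_set H h & x = f * h].
Proof. by case=> F [KH _]; exists (fsym F) => x /KH/bball_set_fsym. Qed.

(** A ball around the trivial subgroup consists of subgroups of a fixed finite
    set, and a finite subgroup can itself serve as a radius. *)
Lemma linked_trivial H :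
  @linked (sg_hyperballean G) trivial_subgroup H <-> finite_set (sg_set H).
Proof.
split.
  move=> /linked_cover[F HF]; apply: (@sub_finite_set _ _ [set` F]) => //.
  by move=> x /HF[f [h [Ff -> ->]]]; rewrite mulg1.
case/finite_fsetP => F HF; apply: (@linkedI _ _ F) => x.
  by rewrite HF => xF; rewrite -[x]mulg1; apply: bball_setM.
by move=> ->; apply/bball_set_id/sg1.
Qed.

Lemma cycle_id g : sg_set (cycle_subgroup g) g.
Proof. by exists 1%R. Qed.

Lemma cycle_infinite g : (forall n, 0 < n -> g ^+ n <> 1) ->
  ~ finite_set (sg_set (cycle_subgroup g)).
Proof.
move=> infg /finite_fsetP[F gF].
have [|i [j [ij]]] := @pigeonhole _ (enum_fset F) (fun n => g ^+ n).
  move=> n; have : [set` F] (g ^+ n) by rewrite -gF; exists (Posz n).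
  by [].
by move=> /(@zexp_inj _ _ infg (Posz i) (Posz j))[]; lia.
Qed.

Lemma zexp_torsion g n a : 0 < n -> g ^+ n = 1 ->
  exists2 k, k < n & zexp g a = g ^+ k.
Proof.
move=> n_gt0 gn; have r_ge0 := modz_ge0 a (d := Posz n).
exists `|(a %% Posz n)%Z|%N; first by have := ltz_mod a (d := Posz n); lia.
rewrite {1}(divz_eq a (Posz n)) zexpD mulrC -zexpM /= gn.
have -> : zexp 1 (a %/ Posz n)%Z = 1 :> G.
  by case: (a %/ Posz n)%Z => m /=; rewrite expg1n ?invg1.
by rewrite mul1g; case: (a %% Posz n)%Z r_ge0 => //; lia.
Qed.

Lemma torsion_cycle_finite g n : 0 < n -> g ^+ n = 1 ->
  finite_set (sg_set (cycle_subgroup g)).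
Proof.
move=> n_gt0 gn.
apply: (@sub_finite_set _ _ [set` [fset g ^+ i | i in iota 0 n]%fset]) => //.
move=> _ [a ->] /=; have [k kn ->] := zexp_torsion a n_gt0 gn.
by apply/imfsetP; exists k; rewrite //= mem_iota.
Qed.

End Subgroups.

(** * Isomorphic groups have asymorphic hyperballeans *)

Definition image_subgroup (G H : groupType) (f : {multiplicative G -> H})
  (K : subgroup G) : subgroup H.
Proof.
exists (f @` sg_set K).
- by exists 1; rewrite ?hom1 //; apply: sg1.
- by move=> _ _ [x Kx <-] [y Ky <-]; exists (x * y); rewrite ?gmulfM //; apply: sgM.
- by move=> _ [x Kx <-]; exists x^-1; rewrite ?homV //; apply: sgV.
Defined.

Lemma image_bornologous (G H : groupType) (f : {multiplicative G -> H}) :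
  @bornologous (sg_hyperballean G) (sg_hyperballean H) (image_subgroup f).
Proof.
have im (A B : set G) (F : {fset G}) :
    B `<=` @bball_set (finitary_ballean G) A F ->
    f @` B `<=` @bball_set (finitary_ballean H) (f @` A) [fset f x | x in F]%fset.
  move=> AB _ [x /AB[a Aa xa] <-]; exists (f a); first by exists a.
  have fF g : g \in F -> [set` [fset f x | x in F]%fset] (f g).
    by move=> Fg; apply: in_imfset.
  case: xa => [[->|[g Fg <-]]|[g Fg <-]]; first by left; left.
    by left; right; exists (f g); rewrite ?gmulfM //; apply: fF.
  by right; exists (f g); rewrite ?gmulfM ?homV //; apply: fF.
move=> F; exists [fset f x | x in F]%fset => K _ [K' [KK' K'K] <-].
by split; apply: im.
Qed.

Lemma isomorphic_asymorphic (G H : groupType) : isomorphic_groups G H ->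
  asymorphic (sg_hyperballean G) (sg_hyperballean H).
Proof.
case=> f [g fK gK].
pose g' : {multiplicative H -> G} :=
  HB.pack g (isMultiplicative.Build H G g (can2_gmulfM fK gK)).
exists (image_subgroup f), (image_subgroup g'); split.
- move=> K; apply: subgroup_ext => x; split.
    by move=> [_ [y Ky <-] <-] /=; rewrite fK.
  by move=> Kx; exists (f x); [exists x|apply: fK].
- move=> K; apply: subgroup_ext => x; split.
    by move=> [_ [y Ky <-] <-] /=; rewrite gK.
  by move=> Kx; exists (g x); [exists x|apply: gK].
- exact: image_bornologous.
- exact: image_bornologous.
Qed.

(** * The subgroups of Z *)

Definition multiples (n : nat) : subgroup Zgroup.
Proof.
exists [set x : Zgroup | (n %| (x : int))%Z].
- exact: dvdz0.
- by move=> x y /= nx ny; exact: (rpredD nx ny).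
- by move=> x /= nx; rewrite -rpredN in nx.
Defined.

Lemma Zgroup_subgroup (K : subgroup Zgroup) : exists n, K = multiples n.
Proof.
have KM (x a : int) : sg_set K x -> sg_set K (x * a)%R.
  by move=> /(subgroupZ a); rewrite zexp_Zgroup.
have KD (x y : int) : sg_set K x -> sg_set K y -> sg_set K (x + y)%R.
  exact: sgM.
have K0 : sg_set K (0%R : int) := sg1 K.
(* The generator is the least positive element, if there is one. *)
pose posK n := `[< 0 < n /\ sg_set K (Posz n) >].
have [exP|K_triv] := pselect (exists n, posK n); last first.
  exists 0; apply: subgroup_ext => x /=; rewrite dvd0z.
  split; last by move=> /eqP x0; rewrite x0.
  move=> Kx; apply/eqP; apply: contrapT => x0; case: K_triv; exists `|(x : int)|%N.
  apply/asboolP; split; first by lia.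
  have [->|->] : Posz `|(x : int)|%N = ((x : int) * 1)%R \/
    Posz `|(x : int)|%N = ((x : int) * -1)%R by lia.
  - exact: KM.
  - exact: KM.
case: (ex_minnP exP) => n /asboolP[n_gt0 Kn] nmin; exists n.
apply: subgroup_ext => x /=; split; last first.
  by move=> /dvdzP[a ->]; rewrite mulrC; apply: KM.
move=> Kx; have Kr : sg_set K ((x : int) %% n)%Z.
  have -> : ((x : int) %% n)%Z = ((x : int) + Posz n * - ((x : int) %/ n)%Z)%R.
    by have := divz_eq (x : int) n; lia.
  by apply: KD => //; apply: KM.
apply/dvdz_mod0P; apply: contrapT => r0.
have r_ge0 : (0 <= ((x : int) %% n)%Z)%R by apply: modz_ge0; lia.
have r_lt : (((x : int) %% n)%Z < n)%R by apply: ltz_pmod; lia.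
have := nmin `|((x : int) %% n)%Z|%N.
have -> : posK `|((x : int) %% n)%Z|%N.
  apply/asboolP; split; first by lia.
  by rewrite gez0_abs.
by move=> /(_ isT); lia.
Qed.

(** * The hyperballean of Z is a ray *)

Lemma Zball_bound (F : {fset Zgroup}) : exists M : nat, forall (A : set Zgroup) x,
  @bball_set (finitary_ballean Zgroup) A F x ->
  exists2 a, A a & (`|(x : int) - (a : int)| <= M%:Z)%R.
Proof.
exists (\max_(f <- fsym F) `|(f : int)|%N) => A x /bball_set_fsym[f [a [Ff Aa ->]]].
exists a => //.
have := @leq_bigmax_seq _ _ xpredT (fun f : Zgroup => `|(f : int)|%N) _ Ff isT.
rewrite -[f * a]/((f : int) + (a : int))%R /=; lia.
Qed.

(** If i does not divide j, then j is at some distance d with 0 < d <= M from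
    iZ.  As jZ stays within M of iZ, so does jZ + iZ, which contains the
    multiples of d; one of them lies in the interval (M, 2M], and it is within
    M of iZ without being too close to 0, so i <= 3M. *)
Lemma multiples_near (i j M : nat) :
  (forall x : int, (j %| x)%Z ->
    exists2 y : int, (i %| y)%Z & (`|x - y| <= M%:Z)%R) ->
  ~~ (i %| j) -> i <= (3 * M)%N.
Proof.
move=> near ndvd; have [//|y iy jy] := near j; pose f := (Posz j - y)%R.
have nif : ~~ (i %| f)%Z.
  by apply: contra ndvd => /rpredD/(_ iy); rewrite subrK.
have f_gt0 : 0 < `|f|%N by move: nif; case: (f) => [[|n]|n]; rewrite ?dvdz0.
have fM : `|f|%N <= M by rewrite -lez_nat abszE.
(* The first multiple of f whose absolute value exceeds M. *)
pose k := (M %/ `|f|).+1.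
have kf : M < `|f| * k <= 2 * M.
  by rewrite mulnC ltn_ceil //= /k mulSn mul2n -addnn leq_add ?leq_divM.
have [|z iz jz] := near (Posz j * Posz k)%R; first exact: dvdz_mulr.
have iw : (i %| (f * Posz k - (Posz j * Posz k - z))%R)%Z.
  rewrite (_ : _ - _ = z - y * Posz k)%R; last by rewrite /f; ring.
  by rewrite rpredB // dvdz_mulr.
have {}kf : M < `|(f * Posz k)%R|%N <= 2 * M by rewrite abszM.
move: (f * Posz k)%R (Posz j * Posz k - z)%R kf jz iw => a b aM bM.
have ab_gt0 : 0 < `|(a - b)%R|%N by clear -aM bM; lia.
move=> /(dvdn_leq ab_gt0); clear -aM bM; lia.
Qed.

Definition multiples_ray (a : option nat) : subgroup Zgroup :=
  multiples (if a is Some n then n.+1 else 0).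

Lemma multiples_inj : injective multiples.
Proof.
move=> m n mn; apply/eqP; rewrite eqn_dvd; apply/andP; split.
  have : sg_set (multiples n) (Posz n) by exact: dvdzz.
  by rewrite -mn.
have : sg_set (multiples m) (Posz m) by exact: dvdzz.
by rewrite mn.
Qed.

(** At radius F only the subgroups nZ with n <= 3M have neighbours other than
    themselves, where M bounds the absolute values in F. *)
Lemma Z_ray : @ray (sg_hyperballean Zgroup) multiples_ray.
Proof.
split.
- apply: inj_surj_bijective => [[i|] [j|] /multiples_inj //|K]; first by case=> ->.
  by have [[|n] ->] := Zgroup_subgroup K; [exists None|exists (Some n)].
- move=> F; have [M MP] := Zball_bound F; exists (3 * M)%N.
  pose near i j := @bball (sg_hyperballean Zgroup) (multiples i) F (multiples j).
  have gt0 i j : near i j -> 0 < j -> 0 < i.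
    case: i => // -[] ji _ j_gt0; case: (MP _ (Posz j * M.+1)%R (ji _ _)).
      exact: dvdz_mulr.
    by move=> y /=; rewrite dvd0z => /eqP->; rewrite subr0; nia.
  have main i j : near i j -> 0 < j -> i <> j -> i <= (3 * M)%N.
    move=> [ji ij] j_gt0 neq.
    have nij := @multiples_near i j M (fun x jx => MP _ x (ji x jx)).
    have nji := @multiples_near j i M (fun x ix => MP _ x (ij x ix)).
    have [dij|] := boolP (i %| j); last exact: nij.
    have [dji|/nji] := boolP (j %| i).
      by case: neq; apply/eqP; rewrite eqn_dvd dij.
    exact/leq_trans/dvdn_leq.
  move=> a b ab; have ba := (bball_sym _ _ _).1 ab.
  case: a b ab ba => [i|] [j|] ab ba; last by left.
  + have [->|ij] := eqVneq i j; [by left|right]; split=> /=.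
      by apply/ltnW/(main _ _ ab isT) => -[] /eqP; apply/negP.
    by apply/ltnW/(main _ _ ba isT) => -[] /esym/eqP; apply/negP.
  + by have := gt0 _ _ ba isT.
  + by have := gt0 _ _ ab isT.
- move=> N; exists [fset (Posz k : Zgroup) | k in iota 0 N.+1]%fset.
  have main i (x : int) : i <= N -> @bball_set (finitary_ballean Zgroup)
      (sg_set (multiples i.+1)) [fset (Posz k : Zgroup) | k in iota 0 N.+1]%fset x.
    move=> iN; have := divz_eq x i.+1.
    have := modz_ge0 x (d := Posz i.+1); have := ltz_pmod x (d := Posz i.+1).
    move=> /(_ isT) lt /(_ isT) ge xE.
    have -> : x = ((x %% i.+1)%Z : Zgroup) * ((x %/ i.+1)%Z * i.+1)%R.
      by rewrite {1}xE addrC.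
    apply: bball_setM; last exact: dvdz_mull.
    apply/imfsetP; exists `|(x %% i.+1)%Z|%N; last by lia.
    rewrite mem_iota /=; lia.
  by case=> [i|//] [j|//] iN jN; split=> x _; apply: main.
Qed.

(** * Towers of p-th roots *)

Lemma expg_coprime (G : groupType) (x : G) (k m : nat) :
  x ^+ m = 1 -> coprime k m -> exists u, (x ^+ k) ^+ u = x.
Proof.
move=> xm; case: (posnP k) => [->|k_gt0 cop].
  by rewrite /coprime gcd0n => /eqP m1; exists 0; rewrite -[RHS]expg1 -m1 xm.
case: (egcdnP m k_gt0) => u v uE _; exists u.
by rewrite -expgnA mulnC uE (eqP cop) addn1 expgS mulnC expgnA xm expg1n mulg1.
Qed.

(** The element [g n] has order [p ^ n] (see [chain_order] below), so a tower,
    where every element is a power of some [g n], presents the group as an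
    increasing union of cyclic groups of orders 1, p, p^2 and so on. *)
Record root_chain (G : groupType) (p : nat) (g : nat -> G) : Prop := RootChain {
  chain0 : g 0 = 1;
  chain1 : g 1%N <> 1;
  chainS : forall n, g n.+1 ^+ p = g n
}.

Record tower (G : groupType) (p : nat) (g : nat -> G) : Prop := Tower {
  tower_chain :> root_chain p g;
  tower_gen : forall x, exists n k, x = g n ^+ k
}.

Section RootChain.
Variables (G : groupType) (p : nat) (g : nat -> G).
Hypotheses (p_pr : prime p) (gC : root_chain p g).

Lemma chainX n m : g (n + m) ^+ (p ^ m) = g n.
Proof.
elim: m => [|m IHm]; first by rewrite addn0 expg1.
by rewrite addnS expnS expgnA (chainS gC).
Qed.

Lemma chain_order n k : g n ^+ k = 1 <-> p ^ n %| k.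
Proof.
elim: n k => [|n IHn] k; first by rewrite (chain0 gC) expg1n dvd1n.
split; last first.
  move=> /dvdnP[q ->]; rewrite mulnC expgnA.
  by have := chainX 0 n.+1; rewrite add0n (chain0 gC) => ->; rewrite expg1n.
move=> gk; have /IHn/dvdnP[q kE] : g n ^+ k = 1.
  by rewrite -(chainS gC) -expgnA mulnC expgnA gk expg1n.
move: gk; rewrite kE mulnC expgnA -add1n chainX => g1q.
rewrite addnC addn1 expnSr dvdn_pmul2l ?expn_gt0 ?prime_gt0 //.
have [//|] := boolP (p %| q); rewrite -prime_coprime // coprime_sym => cop.
have [] := @expg_coprime _ (g 1%N) q p _ cop.
  by rewrite (chainS gC) (chain0 gC).
by move=> u; rewrite g1q expg1n => /esym/(chain1 gC).
Qed.

Lemma chain_mod n a b : g n ^+ a = g n ^+ b <-> a = b %[mod p ^ n].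
Proof.
wlog ab : a b / a <= b.
  by case: (leqP a b) => [|/ltnW] ? W; [exact: W|split=> /esym/W/esym; exact].
rewrite -{1}(subnKC ab) expgnDr -{1}[g n ^+ a]mulg1.
transitivity (g n ^+ (b - a) = 1).
  by split=> [/mulgI/esym|->].
rewrite chain_order; split=> [|/eqP]; last by rewrite eq_sym eqn_mod_dvd.
by rewrite -eqn_mod_dvd // => /eqP.
Qed.

(** The right-hand side does not mention the group: this is what makes the
    correspondence between two towers for the same prime well defined. *)
Lemma chain_eq n k m l :
  g n ^+ k = g m ^+ l <-> p ^ m * k = p ^ n * l %[mod p ^ (n + m)].
Proof.
by rewrite -chain_mod !expgnA chainX addnC chainX.
Qed.

Lemma chain_mul n k m l :
  g n ^+ k * g m ^+ l = g (n + m) ^+ (p ^ m * k + p ^ n * l).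
Proof. by rewrite expgnDr !expgnA chainX addnC chainX. Qed.

End RootChain.

Lemma tower_map (G H : groupType) (p : nat) (g : nat -> G) (h : nat -> H) :
  prime p -> tower p g -> tower p h ->
  exists f : {multiplicative G -> H}, forall n k, f (g n ^+ k) = h n ^+ k.
Proof.
move=> p_pr gT hT.
have gen x : exists c : nat * nat, x = g c.1 ^+ c.2.
  by have [n [k xE]] := tower_gen gT x; exists (n, k).
have [c cE] := choice gen.
pose f x := h (c x).1 ^+ (c x).2.
have fE n k : f (g n ^+ k) = h n ^+ k.
  by apply/(chain_eq p_pr hT)/(chain_eq p_pr gT)/esym/cE.
have fM : {morph f : x y / x * y}.
  by move=> x y; rewrite {1}(cE x) {1}(cE y) (chain_mul gT) fE -(chain_mul hT).
pose F : {multiplicative G -> H} := HB.pack f (isMultiplicative.Build G H f fM).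
by exists F.
Qed.

Lemma tower_isomorphic (G H : groupType) (p : nat) (g : nat -> G) (h : nat -> H) :
  prime p -> tower p g -> tower p h -> isomorphic_groups G H.
Proof.
move=> p_pr gT hT; have [f fE] := tower_map p_pr gT hT.
have [f' f'E] := tower_map p_pr hT gT; exists f, f'.
  by move=> x; have [n [k ->]] := tower_gen gT x; rewrite fE f'E.
by move=> x; have [n [k ->]] := tower_gen hT x; rewrite f'E fE.
Qed.

(** * The hyperballean of a tower group is a ray *)

Section TowerRay.
Variables (G : groupType) (p : nat) (g : nat -> G).
Hypotheses (p_pr : prime p) (gT : tower p g).

Lemma tower_cycleP n x :
  sg_set (cycle_subgroup (g n)) x <-> exists k, x = g n ^+ k.
Proof.
split=> [[a ->]|[k ->]]; last by exists (Posz k).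
have [||k _ ->] := @zexp_torsion _ (g n) (p ^ n) a; last by exists k.
  by rewrite expn_gt0 prime_gt0.
exact/(chain_order p_pr gT).
Qed.

Lemma tower_cycle_le m n : m <= n ->
  sg_set (cycle_subgroup (g m)) `<=` sg_set (cycle_subgroup (g n)).
Proof.
move=> mn x /tower_cycleP[k ->]; apply/subgroupX/tower_cycleP.
by exists (p ^ (n - m))%N; rewrite -(chainX gT m (n - m)) subnKC.
Qed.

Lemma tower_cycle_lt m n : sg_set (cycle_subgroup (g n)) (g m) -> m <= n.
Proof.
move=> /tower_cycleP[k gmk].
have /(chain_order p_pr gT) : g m ^+ (p ^ n) = 1.
  have /(chain_order p_pr gT) gn := dvdnn (p ^ n).
  by rewrite gmk -expgnA mulnC expgnA gn expg1n.
by rewrite dvdn_Pexp2l // prime_gt1.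
Qed.

(** Dividing the exponent by p as often as possible while going down the chain
    leaves an exponent prime to p, which can be inverted modulo p^m; so every
    cyclic subgroup is one of the levels. *)
Lemma tower_level x : exists m,
  sg_set (cycle_subgroup (g m)) x /\ exists l, g m = x ^+ l.
Proof.
have [n [k ->]] := tower_gen gT x; elim: n k => [|n IHn] k.
  exists 0; rewrite (chain0 gT) expg1n; split; first exact: sg1.
  by exists 0.
have [/dvdnP[q ->]|] := boolP (p %| k).
  by rewrite mulnC expgnA (chainS gT); apply: IHn.
rewrite -prime_coprime // coprime_sym => cop; exists n.+1; split.
  exact/subgroupX/cycle_id.
have [||l gl] := @expg_coprime _ (g n.+1) k (p ^ n.+1); last by exists l.
  exact/(chain_order p_pr gT).
exact: coprimeXr.
Qed.

(** A proper subgroup misses some level; it is the last level it contains, since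
    by [tower_level] each of its elements generates a level. *)
Lemma tower_subgroup K :
  K = full_subgroup G \/ exists n, K = cycle_subgroup (g n).
Proof.
have [exP|noP] := pselect (exists n, `[< ~ sg_set K (g n) >]); last first.
  left; apply: subgroup_ext => x; split=> // _.
  have [n [k ->]] := tower_gen gT x; apply: subgroupX.
  by apply: contrapT => Kgn; apply: noP; exists n; apply/asboolP.
right; case: (ex_minnP exP) => -[|m] /asboolP Km minm.
  by case: Km; rewrite (chain0 gT); apply: sg1.
have Kgm i : i <= m -> sg_set K (g i).
  move=> im; apply: contrapT => Ki.
  by have := minm i (introT (asboolP _) Ki); rewrite ltnNge im.
exists m; apply: subgroup_ext => x; split; last first.
  by case=> a ->; apply/subgroupZ/Kgm.
move=> Kx; have [i [ix [l gi]]] := tower_level x.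
apply: tower_cycle_le ix; rewrite -ltnS ltnNge; apply/negP => mi; apply: Km.
have /tower_cycleP[k ->] := tower_cycle_le mi (cycle_id (g m.+1)).
by rewrite gi; do 2! apply: subgroupX.
Qed.

(** The finite radius F lies in some level m. *)
Lemma tower_ball_bound (F : {fset G}) : exists m, forall n,
  @bball_set (finitary_ballean G) (sg_set (cycle_subgroup (g n))) F
    `<=` sg_set (cycle_subgroup (g (maxn n m))).
Proof.
have [lvl lvlP] := choice tower_level.
exists (\max_(f <- fsym F) lvl f) => n x /bball_set_fsym[f [a [Ff ga ->]]].
apply: sgM; last by apply: tower_cycle_le ga; apply: leq_maxl.
apply: tower_cycle_le (lvlP f).1; apply: leq_trans (leq_maxr _ _).
exact: leq_bigmax_seq.
Qed.

Definition tower_ray (a : option nat) : subgroup G :=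
  if a is Some n then cycle_subgroup (g n) else full_subgroup G.

(** A ball of radius F inside level m cannot reach above level max(n, m) from
    level n; hence it cannot reach the whole group, and it only links two
    distinct levels when both are at most m. *)
Lemma tower_is_ray : @ray (sg_hyperballean G) tower_ray.
Proof.
have full_sub n : ~ sg_set (full_subgroup G) `<=` sg_set (cycle_subgroup (g n)).
  by move=> /(_ (g n.+1) I)/tower_cycle_lt; rewrite ltnn.
have cycle_sub i n : sg_set (cycle_subgroup (g i)) `<=`
    sg_set (cycle_subgroup (g n)) -> i <= n.
  by move=> /(_ (g i) (cycle_id _))/tower_cycle_lt.
split.
- apply: inj_surj_bijective => [|K]; last first.
    by have [->|[n ->]] := tower_subgroup K; [exists None|exists (Some n)].
  case=> [i|] [j|] //= eqK.
  + by congr Some; apply/eqP; rewrite eqn_leq !cycle_sub // eqK.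
  + by case: (full_sub i); rewrite eqK.
  + by case: (full_sub j); rewrite eqK.
- move=> F; have [m mP] := tower_ball_bound F; exists m => a b.
  case: a b => [i|] [j|] [/= ji ij]; last by left.
  + have /cycle_sub := subset_trans ji (mP i).
    have /cycle_sub := subset_trans ij (mP j).
    have [->|neq] := eqVneq i j; first by left.
    by right; split=> /=; lia.
  + by case: (full_sub _ (subset_trans ji (mP i))).
  + by case: (full_sub _ (subset_trans ij (mP j))).
- move=> N; exists [fset g N ^+ k | k in iota 0 (p ^ N)]%fset.
  have main i j : j <= N -> sg_set (cycle_subgroup (g j)) `<=`
      @bball_set (finitary_ballean G) (sg_set (cycle_subgroup (g i)))
        [fset g N ^+ k | k in iota 0 (p ^ N)]%fset.
    move=> jN x /(tower_cycle_le jN)[a ->].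
    have [||k kN ->] := @zexp_torsion _ (g N) (p ^ N) a.
    + by rewrite expn_gt0 prime_gt0.
    + exact/(chain_order p_pr gT).
    rewrite -[_ ^+ k]mulg1; apply: bball_setM; last exact: sg1.
    by apply/imfsetP; exists k; rewrite //= mem_iota.
  by case=> [i|//] [j|//] iN jN; split; apply: main.
Qed.

End TowerRay.

(** * The Pruefer groups are the tower groups *)

(** A primitive p-th root of unity followed by iterated p-th roots; a root of
    unity of order dividing p^n is a power of the n-th term because that term
    is primitive. *)
Lemma pruefer_tower (p : nat) (p_pr : prime p) :
  exists g : nat -> pruefer_group p_pr, tower p g.
Proof.
have p_gt0 := prime_gt0 p_pr.
have [w wP] := C_prim_root_exists p_gt0.
pose z := fun n => if n is m.+1 then iter m (p.-root) w else 1%R : algC.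
have zS n : (z n.+1 ^+ p = z n)%R.
  by case: n => [|n]; [apply: prim_expr_order wP|rewrite /= rootCK].
have z1 : z 1%N <> 1%R.
  move=> w1; have := prim_order_dvd wP 1%N; rewrite expr1 [w]w1 eqxx dvdn1.
  by move=> /eqP p1; move: p_pr; rewrite p1.
have zX n m : (z (n + m)%N ^+ (p ^ m) = z n)%R.
  elim: m => [|m IHm]; first by rewrite addn0 expr1.
  by rewrite addnS expnS exprM zS.
have zpred n : pruefer_pred p (z n).
  by apply/asboolP; exists n; have := zX 0%N n.
pose g n : pruefer_group p_pr := exist _ (z n) (zpred n).
have val_g n k : sval (g n ^+ k) = (z n ^+ k)%R.
  by elim: k => [|k IHk] //; rewrite expgS exprS -IHk.
exists g; split.
  split; [exact/val_inj|by move=> /(congr1 sval)|].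
  by move=> n; apply: val_inj; rewrite /= val_g zS.
case=> x xP; have /asboolP[n xn] := xP; exists n.
have zn : ((p ^ n)%N.-primitive_root (z n))%R.
  have [||m mP] := @prim_order_exists _ (p ^ n) (z n).
  - by rewrite expn_gt0 p_gt0.
  - exact: (zX 0%N n).
  case/(dvdn_pfactor _ _ p_pr) => j; rewrite leq_eqVlt => /predU1P[->|jn] mE.
    by rewrite -mE.
  case: n jn {xn} mP => // n; rewrite ltnS => jn mP; case: z1.
  rewrite -(zX 1%N n) add1n; apply/eqP; rewrite -(prim_order_dvd mP) mE.
  exact: dvdn_exp2l.
have [k xk] := prim_rootP zn xn; exists k; apply: val_inj.
by rewrite /= val_g xk.
Qed.

(** * Torsion-free groups whose nontrivial cyclic subgroups have finite index *)

(** The cyclic subgroup generated by z has finite index, in the form in which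
    it is read off a ball: finitely many left translates cover the group. *)
Definition finite_index_cycle (G : groupType) (z : G) := exists F : {fset G},
  forall x, exists f k, f \in F /\ x = f * zexp z k.

Section Transfer.
Variables (G : groupType) (z : G).
Hypotheses (z_central : forall x, commute x z) (z_inj : injective (zexp z)).
Hypothesis z_index : finite_index_cycle z.

(** [choose] only depends on the extension of its predicate, so this picks one
    representative in each left coset of the subgroup generated by z. *)
Let rep (x : G) : G := choose (fun y => `[< exists k, y = x * zexp z k >]) x.

Let repP x : exists k, rep x = x * zexp z k.
Proof.
by apply/asboolP/(@chooseP _ (fun y => `[< exists k, y = x * zexp z k >]));
  apply/asboolP; exists 0%R; rewrite mulg1.
Qed.

Let rep_coset x k : rep (x * zexp z k) = rep x.
Proof.
rewrite /rep; set P := (P in choose P); set Q := (Q in _ = choose Q x).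
have PQ : P =1 Q.
  move=> y; apply/asboolP/asboolP=> -[l ->].
    by exists (k + l)%R; rewrite zexpD mulgA.
  by exists (l - k)%R; rewrite -mulgA -zexpD; congr (_ * zexp _ _); lia.
rewrite (eq_choose PQ); apply: choose_id.
- by rewrite -PQ; apply/asboolP; exists 0%R; rewrite mulg1.
- by apply/asboolP; exists 0%R; rewrite mulg1.
Qed.

Let rep_id x : rep (rep x) = rep x.
Proof. by have [k {1}->] := repP x; apply: rep_coset. Qed.

Let phi_ex x : exists k, x = rep x * zexp z k.
Proof.
have [k ->] := repP x; exists (- k)%R.
by rewrite zexpN mulgK.
Qed.

Let phi (x : G) : int := projT1 (cid (phi_ex x)).

Let phiE x : x = rep x * zexp z (phi x).
Proof. exact: projT2 (cid (phi_ex x)). Qed.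

Let phiZ x k : phi (x * zexp z k) = (phi x + k)%R.
Proof.
apply: z_inj; apply: (mulgI (rep x)).
by rewrite -{1}(rep_coset x k) -phiE zexpD mulgA -phiE.
Qed.

Let phi_rep x : phi (rep x) = 0%R.
Proof.
by apply: z_inj; apply: (mulgI (rep x)); rewrite mulg1 -{1}rep_id -phiE.
Qed.

(** The transfer homomorphism.  Let R be the set of coset representatives and
    [phi x] the exponent with x = rep x * z^(phi x).  The sum of the
    phi (x * r) over r in R is additive in x, because r |-> rep (y * r)
    permutes R; its value at z is the cardinal of R. *)
Lemma transfer : exists T : {multiplicative G -> Zgroup}, T z <> (0%R : int).
Proof.
have [F FP] := z_index.
pose R := [fset rep f | f in F]%fset.
have RP x : rep x \in R.
  have [f [k [Ff ->]]] := FP x; rewrite rep_coset; exact: in_imfset.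
have R_rep r : r \in R -> rep r = r.
  by case/imfsetP => f _ ->; apply: rep_id.
pose T (x : G) : Zgroup := (\sum_(r <- R) phi (x * r))%R.
have sigma y : perm_eq [seq rep (y * r) | r <- R] R.
  have uniq_y : uniq [seq rep (y * r) | r <- R].
    rewrite map_inj_in_uniq ?fset_uniq // => r s Rr Rs eqrs.
    rewrite -(R_rep r Rr) -(R_rep s Rs).
    rewrite (_ : r = s * zexp z (phi (y * r) - phi (y * s))%R) ?rep_coset //.
    apply: (mulgI y); rewrite mulgA {1}[y * r]phiE eqrs {2}[y * s]phiE -mulgA -zexpD.
    by congr (_ * zexp _ _); lia.
  apply: uniq_perm (fset_uniq _) (uniq_min_size uniq_y _ _).2 => //.
    by move=> _ /mapP[r _ ->]; apply: RP.
  by rewrite size_map.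
have TM : {morph T : x y / x * y}.
  move=> x y; rewrite -[RHS]/((T x : int) + (T y : int))%R.
  have -> : T x = (\sum_(r <- R) phi (x * rep (y * r)))%R.
    by rewrite /T -(perm_big _ (sigma y)) big_map.
  rewrite /T -big_split /=; apply: eq_bigr => r _.
  by rewrite -phiZ; congr phi; rewrite -!mulgA -phiE.
pose T' : {multiplicative G -> Zgroup} :=
  HB.pack T (isMultiplicative.Build G Zgroup T TM).
exists T'; rewrite -[T' z]/(T z) /T.
rewrite (eq_big_seq (fun=> 1%R : int)) => [|r Rr].
  rewrite big_const_seq count_predT iter_addr_0 natz => -[] /size0nil R0'.
  by have : rep 1 \in enum_fset R := RP 1; rewrite R0'.
by rewrite -z_central -[z in LHS]zexp1 phiZ -(R_rep r Rr) phi_rep.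
Qed.

End Transfer.

Section TorsionFree.
Variable G : groupType.
Hypothesis torsion_free : forall (x : G) n, 0 < n -> x ^+ n = 1 -> x = 1.
Hypothesis cycles_index : forall x : G, x <> 1 -> finite_index_cycle x.

(** Among infinitely many powers of y, two lie in the same coset of the subgroup
    generated by x. *)
Let common_power (x y : G) : x <> 1 ->
  exists n k, 0 < n /\ y ^+ n = zexp x k.
Proof.
move=> /cycles_index[F FP].
have [f fP] := choice (fun n => FP (y ^+ n)).
have [|i [j [ij fij]]] := @pigeonhole _ (enum_fset F) f.
  by move=> n; have [k []] := fP n.
have [k [_ yi]] := fP i; have [l [_ yj]] := fP j.
exists (j - i)%N, (- k + l)%R; split; first by rewrite subn_gt0.
apply: (mulgI (y ^+ i)); rewrite -expgnDr subnKC 1?ltnW //.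
by rewrite yi yj -fij -mulgA -zexpD; congr (_ * zexp _ _); lia.
Qed.

Let inf_order (x : G) : x <> 1 -> forall n, 0 < n -> x ^+ n <> 1.
Proof. by move=> x1 n n_gt0 /(torsion_free n_gt0). Qed.

(** Each of the finitely many coset representatives f of the subgroup generated
    by g commutes with some positive power of g, namely one that is also a
    power of f; the product of the exponents works for all of them. *)
Lemma central_power (g : G) : g <> 1 ->
  exists2 n, 0 < n & forall x, commute x (g ^+ n).
Proof.
move=> g1; have [F FP] := cycles_index g1.
have powP (f : G) : exists n, 0 < n /\ commute f (g ^+ n).
  have [->|/eqP f1] := eqVneq f 1.
    by exists 1%N; split=> //; apply/commute_sym/commute1.
  have [n [k [n_gt0 gn]]] := common_power g f1.
  by exists n; split=> //; rewrite gn; apply: zexp_commute.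
have [a aP] := choice powP.
exists (\prod_(f <- F) a f)%N; first by apply: prodn_gt0 => f; case: (aP f).
move=> x; have [f [k [Ff ->]]] := FP x.
apply/commute_sym/commuteM; last exact/zexp_commute/commute_sym/commuteX.
apply/commute_sym; rewrite (big_rem f) //= expgnA.
by apply: commuteX; case: (aP f).
Qed.

(** The transfer towards a central power z of g is injective: if T x = 0, then
    x^k = z^a with k > 0 forces a = 0, so x is torsion.  A nontrivial subgroup
    of Z is isomorphic to Z. *)
Lemma torsion_free_finite_index_Z : (exists g : G, g <> 1) ->
  isomorphic_groups G Zgroup.
Proof.
case=> g g1; have [n n_gt0 z_central] := central_power g1.
set z := g ^+ n in z_central.
have z1 : z <> 1 by apply: inf_order.
have z_inj : injective (zexp z) by apply/zexp_inj/inf_order.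
have [T Tz] := transfer z_central z_inj (cycles_index z1).
have [m mE] := Zgroup_subgroup (image_subgroup T (full_subgroup G)).
have mT x : (m %| (T x : int))%Z.
  by have : sg_set (multiples m) (T x) by rewrite -mE; exists x.
have m0 : m <> 0.
  by move=> m0; apply/Tz/eqP; move: (mT z); rewrite m0 dvd0z.
pose u (x : G) : Zgroup := ((T x : int) %/ m)%Z.
have uM : {morph u : x y / x * y}.
  by move=> x y; rewrite /u gmulfM; exact: divzDl.
pose U : {multiplicative G -> Zgroup} :=
  HB.pack u (isMultiplicative.Build G Zgroup u uM).
have T_inj x : T x = 1 -> x = 1.
  move=> Tx; have [k [a [k_gt0 xk]]] := common_power x z1.
  have /eqP : T (x ^+ k) = 1 by rewrite homX Tx expg1n.
  rewrite xk hom_zexp => /eqP Tza.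
  have : ((T z : int) * a)%R = 0%R by rewrite -zexp_Zgroup.
  move=> /eqP; rewrite mulf_eq0 => /orP[/eqP//|/eqP a0].
  by apply: (torsion_free k_gt0); rewrite xk a0.
exists U; apply: inj_surj_bijective => [x y|b].
  move=> /(congr1 (fun c : int => c * m)%R); rewrite /= !divzK // => Txy.
  apply: divg1_eq; apply: T_inj.
  by rewrite gmulfM homV Txy mulgV.
have : sg_set (multiples m) ((b : int) * Posz m)%R by exact: dvdz_mull.
rewrite -mE => -[x _ Tx]; exists x; rewrite -[U x]/(u x) /u Tx mulzK //.
by apply/eqP; case.
Qed.

End TorsionFree.

(** * Groups with an element of infinite order *)

(** An element g of infinite order generates a subgroup linked to a different
    one, that of g^2, so it is not the isolated point.  It is not linked to
    the trivial subgroup, which must therefore be the isolated point.  Hence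
    all nontrivial subgroups are infinite and commensurable with G. *)
Lemma asymorphic_infinite_order (G : groupType) :
  (exists g : G, forall n, 0 < n -> g ^+ n <> 1) ->
  asymorphic (sg_hyperballean G) (sg_hyperballean Zgroup) ->
  isomorphic_groups G Zgroup.
Proof.
case=> g g_inf /asymorphic_ray_linked/(_ Z_ray)[iso [_ linkedE]].
pose C := cycle_subgroup g; pose D := cycle_subgroup (zexp g 2%R).
have CD : @linked (sg_hyperballean G) C D.
  apply: (@linkedI _ _ _ [fset g]%fset) => x.
    by case=> a ->; apply/bball_set_id; exists (2 * a)%R; rewrite zexpM.
  case=> a ->; have [[b ->]|[b ->]] :
      (exists b, a = 2 * b)%R \/ (exists b, a = 1 + 2 * b)%R.
  - have := divz_eq a 2; have := modz_ge0 a (d := 2); have := ltz_pmod a (d := 2).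
    move=> /(_ isT) lt /(_ isT) ge aE.
    have [r|r] : (a %% 2)%Z = 0%R \/ (a %% 2)%Z = 1%R by lia.
      by left; exists (a %/ 2)%Z; lia.
    by right; exists (a %/ 2)%Z; lia.
  - by apply/bball_set_id; exists b; rewrite zexpM.
  - rewrite zexpD; apply: bball_setM; first by rewrite inE.
    by exists b; rewrite zexpM.
have C_not_iso : C <> iso.
  case/linkedE: CD => [eqCD|[]//].
  have [k] : sg_set D g by rewrite -eqCD; apply: cycle_id.
  by rewrite zexpM => /(zexp_inj g_inf (x1 := 1%R)); lia.
have iso1 : iso = trivial_subgroup G.
  apply: contrapT => iso1; apply: (cycle_infinite g_inf); apply/linked_trivial.
  by apply/linkedE; right; split=> // /esym.
have cycle_iso x : x <> 1 -> cycle_subgroup x <> iso.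
  by move=> x1 xiso; apply: x1; have := cycle_id x; rewrite xiso iso1.
have g1 : g <> 1 by move=> g1; apply: (g_inf 1%N).
apply: torsion_free_finite_index_Z; last by exists g.
- move=> x n n_gt0 xn; apply: contrapT => x1.
  have /linked_trivial/linkedE[|[]] := torsion_cycle_finite n_gt0 xn.
    by rewrite -iso1 => /esym; apply: cycle_iso.
  by rewrite iso1.
- move=> x x1; have /linked_cover[F FP] :
      @linked (sg_hyperballean G) (cycle_subgroup x) (full_subgroup G).
    apply/linkedE; right; split; first exact: cycle_iso.
    move=> fullE; apply: g1.
    by have : sg_set (full_subgroup G) g by []; rewrite fullE iso1.
  by exists F => y; have [//|f [_ [Ff [k ->] ->]]] := FP y; exists f, k.
Qed.

(** * Abelian torsion groups *)

Section AlmostFinite.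
Variable G : groupType.
Hypothesis abelG : forall x y : G, x * y = y * x.
Hypothesis proper_finite : forall K : subgroup G,
  K = full_subgroup G \/ finite_set (sg_set K).

(** Let M be a maximal subgroup without h; it is proper, hence finite.  For x
    outside M, the subgroup generated by M and x contains h = m * x^k with k
    prime to p, so x lies in the subgroup generated by M and h, which is
    finite. *)
Lemma exponent_p_finite (p : nat) (h : G) : prime p -> h <> 1 ->
  (forall x : G, x ^+ p = 1) -> finite_set [set: G].
Proof.
move=> p_pr h1 expp; have p_gt0 := prime_gt0 p_pr.
pose P (A : set G) := (forall x y, A x -> A y -> A (x * y^-1)) /\ ~ A h.
have [|M [[M_div Mh] Mmax]] := @Zorn_bigcup G P.
  move=> S SP totS; split; last by case=> A SA; apply: (SP A SA).2.
  move=> x y [A SA Ax] [B SB By].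
  have [AB|BA] := totS A B SA SB.
    by exists B => //; apply: (SP B SB).1 => //; apply: AB.
  by exists A => //; apply: (SP A SA).1 => //; apply: BA.
have M1 : M 1.
  (* Closure under division leaves only the empty set to exclude; it is
     smaller than the trivial subgroup. *)
  apply: contrapT => M1; apply: (Mmax [set 1]); last first.
    by split=> [x y -> ->|/h1//]; rewrite /= mulgV.
  have M0 x : ~ M x by move=> Mx; apply: M1; rewrite -(mulgV x); apply: M_div.
  by split=> [x /M0//|/(_ 1 erefl)].
have MV x : M x -> M x^-1 by move=> Mx; rewrite -[x^-1]mul1g; apply: M_div.
have MM x y : M x -> M y -> M (x * y).
  by move=> Mx /MV My; rewrite -[y]invgK; apply: M_div.
pose K := Subgroup M1 MM MV.
have finM : finite_set M.
  by have [KG|] := proper_finite K => //; case: Mh; have : sg_set K h by rewrite KG.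
have span x : exists m k, [/\ M m, k < p & x = m * h ^+ k].
  suff [m [u [Mm ->]]] : exists m u, M m /\ x = m * h ^+ u.
    have [k kp hu] := zexp_torsion (Posz u) p_gt0 (expp h).
    by exists m, k; split=> //; rewrite -hu.
  have [Mx|Mx] := pselect (M x); first by exists x, 0; rewrite mulg1.
  pose A := [set y | exists m a, M m /\ y = m * zexp x a].
  have [m [a [Mm hE]]] : A h.
    apply: contrapT => Ah; apply: (Mmax A).
      split=> [y My|]; first by exists y, 0%R; rewrite mulg1.
      by move=> AM; apply/Mx/AM; exists 1, 1%R; rewrite mul1g.
    split=> // _ _ [m [a [Mm ->]]] [m' [a' [Mm' ->]]].
    exists (m * m'^-1), (a - a')%R; split; first exact: M_div.
    rewrite zexpD zexpN invgM -!mulgA; congr (_ * _).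
    by rewrite [RHS]abelG -mulgA; congr (_ * _); apply: abelG.
  have [k kp aE] := zexp_torsion a p_gt0 (expp x).
  have cop : coprime k p.
    rewrite coprime_sym prime_coprime //; apply/negP => /dvdnP[q kE].
    by apply: Mh; rewrite hE aE kE mulnC expgnA expp expg1n mulg1.
  have [u <-] := expg_coprime (expp x) cop.
  have -> : x ^+ k = m^-1 * h by rewrite hE aE mulKg.
  exists (m^-1 ^+ u), u; split; last exact/expgMn/abelG.
  exact/(subgroupX (H := K))/MV.
apply: (@sub_finite_set _ _ (\bigcup_(k in `I_p) ((fun m => m * h ^+ k) @` M))).
  by move=> x _; have [m [k [Mm kp ->]]] := span x; exists k => //; exists m.
by apply: bigcup_finite => // k _; apply: finite_image.
Qed.

Hypothesis infG : ~ finite_set [set: G].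

(** If the group of p-th powers is proper, it is finite, so the kernel of the
    p-th power map has finite index and is infinite, hence everything; this
    contradicts [exponent_p_finite]. *)
Lemma roots_exist (p : nat) (h : G) : prime p -> h <> 1 ->
  forall x : G, exists y, y ^+ p = x.
Proof.
move=> p_pr h1.
have XM (x y : G) : (x * y) ^+ p = x ^+ p * y ^+ p by apply/expgMn/abelG.
pose powers := [set y : G | exists x, x ^+ p = y].
pose kernel := [set x : G | x ^+ p = 1].
have P1 : powers 1 by exists 1; rewrite expg1n.
have PM x y : powers x -> powers y -> powers (x * y).
  by move=> [u <-] [v <-]; exists (u * v).
have PV x : powers x -> powers x^-1.
  by move=> [u <-]; exists u^-1; rewrite expVgn.
have K1 : kernel 1 by rewrite /kernel /= expg1n.
have KM x y : kernel x -> kernel y -> kernel (x * y).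
  by rewrite /kernel /= => xp yp; rewrite XM xp yp mulg1.
have KV x : kernel x -> kernel x^-1.
  by rewrite /kernel /= => xp; rewrite expVgn xp invg1.
pose P := Subgroup P1 PM PV; pose K := Subgroup K1 KM KV.
have [PG x|finP] := proper_finite P; first by have : sg_set P x by rewrite PG.
have [KG|finK] := proper_finite K; case: infG.
  by apply: (exponent_p_finite p_pr h1) => x; have : sg_set K x by rewrite KG.
apply: (@sub_finite_set _ _ (\bigcup_(y in sg_set P) [set x | x ^+ p = y])).
  by move=> x _; exists (x ^+ p) => //; exists x.
apply: bigcup_finite => // _ [x <-].
apply: (@sub_finite_set _ _ ((fun k => x * k) @` sg_set K)).
  move=> y /= yx; exists (x^-1 * y); last exact: mulVKg.
  by rewrite /kernel /= XM expVgn yx mulVg.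
exact: finite_image.
Qed.

Hypothesis torsionG : forall x : G, exists2 n, 0 < n & x ^+ n = 1.

Lemma prime_order_exists : exists p (h : G), [/\ prime p, h <> 1 & h ^+ p = 1].
Proof.
have [g g1] : exists g : G, g <> 1.
  apply: contrapT => no; apply: infG; apply: (@sub_finite_set _ _ [set 1]) => //.
  by move=> x _; apply: contrapT => x1; apply: no; exists x.
have exn : exists n, (0 < n) && (g ^+ n == 1).
  by have [n n_gt0 gn] := torsionG g; exists n; rewrite n_gt0 gn eqxx.
case: (ex_minnP exn) => n /andP[n_gt0 /eqP gn] nmin.
have n_gt1 : 1 < n.
  by case: n n_gt0 gn {nmin} => [|[|n]] // _; rewrite expg1.
have p_pr := pdiv_prime n_gt1; have p_dvd := pdiv_dvd n.
exists (pdiv n), (g ^+ (n %/ pdiv n)); split=> //; last by rewrite -expgnA divnK.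
move=> gnp; have := nmin (n %/ pdiv n); rewrite gnp eqxx andbT.
rewrite divn_gt0 ?prime_gt0 // dvdn_leq // leqNgt ltn_Pdiv ?prime_gt1 //.
by move=> /(_ isT).
Qed.

(** Iterated p-th roots of an element of order p generate an infinite subgroup,
    which has to be the whole group. *)
Lemma tower_exists : exists p, prime p /\ exists g : nat -> G, tower p g.
Proof.
have [p [h [p_pr h1 hp]]] := prime_order_exists.
have [r rP] := choice (roots_exist p_pr h1).
pose g n := if n is m.+1 then iter m r h else 1.
have gC : root_chain p g.
  by split=> // -[|n] //=; apply: rP.
pose union := [set x | exists n k, x = g n ^+ k].
have U1 : union 1 by exists 0, 0.
have UM x y : union x -> union y -> union (x * y).
  move=> [n [k ->]] [m [l ->]]; exists (n + m)%N, (p ^ m * k + p ^ n * l)%N.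
  exact: chain_mul.
have UV x : union x -> union x^-1.
  move=> [n [k ->]]; have gn : g n ^+ (p ^ n) = 1.
    exact/(chain_order p_pr gC).
  have [|l _ gl] := zexp_torsion (- k%:Z)%R _ gn.
    by rewrite expn_gt0 prime_gt0.
  by exists n, l; rewrite -gl zexpN.
pose U := Subgroup U1 UM UV; exists p; split=> //; exists g; split=> // x.
have [UG|/finite_fsetP[F UF]] := proper_finite U.
  by have : sg_set U x by rewrite UG.
have [|i [j [ij gij]]] := @pigeonhole _ (enum_fset F) g.
  move=> n; have : [set` F] (g n) by rewrite -UF; exists n, 1%N.
  by [].
have /(chain_order p_pr gC) : g j ^+ (p ^ i) = 1.
  by rewrite -gij; apply/(chain_order p_pr gC).
by rewrite dvdn_Pexp2l ?prime_gt1 // leqNgt ij.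
Qed.

End AlmostFinite.

(** Here the trivial subgroup is linked to the finite cyclic subgroups, so it
    is not the isolated point.  All subgroups but one are then finite, and the
    remaining one is infinite; it is G, which would otherwise be finite. *)
Lemma asymorphic_torsion_tower (G : groupType) :
  (forall x y : G, x * y = y * x) ->
  (forall x : G, exists2 n, 0 < n & x ^+ n = 1) ->
  asymorphic (sg_hyperballean G) (sg_hyperballean Zgroup) ->
  exists p, prime p /\ exists g : nat -> G, tower p g.
Proof.
move=> abelG torsG /asymorphic_ray_linked/(_ Z_ray)[iso [[A Aiso] linkedE]].
have iso1 : iso <> trivial_subgroup G.
  move=> iso1; apply: Aiso; rewrite iso1; apply: subgroup_ext => x.
  split=> [Ax|->]; last exact: sg1.
  have [n n_gt0 xn] := torsG x.
  have /linked_trivial/linkedE[xE|[]] := torsion_cycle_finite n_gt0 xn.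
    by rewrite xE; apply: cycle_id.
  by rewrite iso1.
have fin K : K <> iso -> finite_set (sg_set K).
  by move=> Kiso; apply/linked_trivial/linkedE; right; split=> // /esym.
have inf_iso : ~ finite_set (sg_set iso).
  by move=> /linked_trivial/linkedE[/esym|[]].
have isoG : iso = full_subgroup G.
  apply: contrapT => isoG; apply: inf_iso.
  by apply: sub_finite_set (fin _ (nesym isoG)).
apply: tower_exists => //.
  by move=> K; rewrite -isoG; have [|/fin] := pselect (K = iso); [left|right].
by move: inf_iso; rewrite isoG.
Qed.

(** * The characterisation *)

Theorem theorem1 (G : groupType) :
  ((exists g : G, forall n : nat, 0 < n -> (g ^+ n)%g <> 1%g) ->
     (asymorphic (sg_hyperballean G) (sg_hyperballean Zgroup) <->
      isomorphic_groups G Zgroup))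
  /\
  ((forall x y : G, (x * y)%g = (y * x)%g) ->
     (asymorphic (sg_hyperballean G) (sg_hyperballean Zgroup) <->
      (isomorphic_groups G Zgroup \/
       exists (p : nat) (p_pr : prime p),
         isomorphic_groups G (pruefer_group p_pr)))).
Proof.
split=> [g_inf|abelG].
  by split; [exact: asymorphic_infinite_order|exact: isomorphic_asymorphic].
split=> [asym|[/isomorphic_asymorphic//|[p [p_pr isoG]]]]; last first.
  apply: asymorphic_trans (isomorphic_asymorphic isoG) _.
  have [g gT] := pruefer_tower p_pr.
  exact: ray_asymorphic (tower_is_ray p_pr gT) Z_ray.
have [g_inf|no_inf] := pselect (exists g : G, forall n, 0 < n -> g ^+ n <> 1).
  by left; apply: asymorphic_infinite_order.
right; have [|p [p_pr [g gT]]] := asymorphic_torsion_tower abelG _ asym.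
  move=> x; apply: contrapT => no; apply: no_inf; exists x => n n_gt0 xn.
  by apply: no; exists n.
have [h hT] := pruefer_tower p_pr.
by exists p, p_pr; apply: tower_isomorphic gT hT.
Qed.
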